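(* Let $m_1,m_2>0$ and consider a solution of the three-body problem of the type described in the context. On any open interval of time on which $\dot r$ does not vanish, write $f(t)=g(r(t))$. Then the function $g=g(r)$ satisfies $$a(r,g,g')\,g''(r)+b(r,g)\,g'(r)+c(r,g)=0,$$ where $$a(r,g,g')=\frac{8(1-k)m_2^2r^2+\big(2c_1^2m_2-r(m_2^2+2c_2r)\big)\sqrt{r^2+k^2g(r)^2}}{2m_2r^2\sqrt{r^2+k^2g(r)^2}\,\big(1+(k-1)k\,g'(r)^2\big)},$$ $$b(r,g)=-\left(\frac{c_1^2}{r^3}-\frac{m_2}{4r^2}-\frac{2(k-1)m_2r}{(r^2+k^2g(r)^2)^{3/2}}\right),\qquad c(r,g)=-\frac{2km_2g(r)}{(r^2+k^2g(r)^2)^{3/2}} .$$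
   Context: The gravitational constant is $1$. The solutions considered are the solutions of the three-body problem with masses $m_1,m_2,m_2$ (positions $x,y,z\in\mathbb{R}^3$) of the form $$x=(0,0,f),\quad y=\Big(r\cos\theta,\,r\sin\theta,\,-\tfrac{m_1}{2m_2}f\Big),\quad z=\Big(-r\cos\theta,\,-r\sin\theta,\,-\tfrac{m_1}{2m_2}f\Big),$$ where $r>0$ and $$\ddot f=-\frac{2m_2kf}{h^3},\qquad \ddot r=\frac{c_1^2}{r^3}-\frac{m_2}{4r^2}-2(k-1)m_2\frac{r}{h^3},\qquad r^2\dot\theta=c_1,$$ with $k=\frac{m_1+2m_2}{2m_2}$, $h=\sqrt{r^2+k^2f^2}$ and $c_1$ a constant. The conserved total energy is $$c_2=\frac{m_2c_1^2}{r^2}-\frac{2m_1m_2}{h}-\frac{m_2^2}{2r}+\frac{m_1^2+2m_1m_2}{4m_2}\dot f^2+m_2\dot r^2 .$$ *)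

(* Defs.v *)
From Stdlib Require Import Reals Lra.
From Coquelicot Require Import Coquelicot.
Open Scope R_scope.

Definition time_interval (a b : Rbar) (t : R) : Prop :=
  Rbar_lt a t /\ Rbar_lt t b.

(* Coquelicot's canonical norm on this iterated product is the Euclidean one. *)
Definition R3 : Type := (R * R * R)%type.

(* Acceleration of a body at [p] due to a body of mass [m] at [q], with
   gravitational constant 1. *)
Definition attraction (m : R) (p q : R3) : R3 :=
  scal (m / norm (minus q p) ^ 3) (minus q p).

Definition three_body_solution (m1 m2 m3 : R) (x y z : R -> R3)
    (J : R -> Prop) : Prop :=
  exists vx vy vz : R -> R3, forall t : R, J t ->
    (x t <> y t /\ x t <> z t /\ y t <> z t) /\
    (is_derive x t (vx t) /\ is_derive y t (vy t) /\ is_derive z t (vz t)) /\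
    is_derive vx t
      (plus (attraction m2 (x t) (y t)) (attraction m3 (x t) (z t))) /\
    is_derive vy t
      (plus (attraction m1 (y t) (x t)) (attraction m3 (y t) (z t))) /\
    is_derive vz t
      (plus (attraction m1 (z t) (x t)) (attraction m2 (z t) (y t))).

Definition kappa (m1 m2 : R) : R := (m1 + 2 * m2) / (2 * m2).

Definition dist_h (m1 m2 s u : R) : R :=
  sqrt (s ^ 2 + kappa m1 m2 ^ 2 * u ^ 2).

(* [Derive] is total, hence the explicit [ex_derive] fields next to the
   second-order equations. *)
Record symmetric_solution (m1 m2 c1 : R) (J : R -> Prop)
    (x y z : R -> R3) (f r theta : R -> R) : Prop := {
  sym_newton : three_body_solution m1 m2 m2 x y z J;
  sym_x : forall t, J t -> x t = (0, 0, f t);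
  sym_y : forall t, J t ->
    y t = (r t * cos (theta t), r t * sin (theta t), - (m1 / (2 * m2)) * f t);
  sym_z : forall t, J t ->
    z t = (- r t * cos (theta t), - r t * sin (theta t),
           - (m1 / (2 * m2)) * f t);
  sym_r_pos : forall t, J t -> 0 < r t;
  sym_f_derivable : forall t, J t -> ex_derive f t;
  sym_r_derivable : forall t, J t -> ex_derive r t;
  sym_theta_derivable : forall t, J t -> ex_derive theta t;
  sym_f_eq : forall t, J t ->
    is_derive (Derive f) t
      (- (2 * m2 * kappa m1 m2 * f t) / dist_h m1 m2 (r t) (f t) ^ 3);
  sym_r_eq : forall t, J t ->
    is_derive (Derive r) t
      (c1 ^ 2 / r t ^ 3 - m2 / (4 * r t ^ 2)
       - 2 * (kappa m1 m2 - 1) * m2 * (r t / dist_h m1 m2 (r t) (f t) ^ 3));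
  sym_theta_eq : forall t, J t -> r t ^ 2 * Derive theta t = c1
}.

Definition total_energy (m1 m2 c1 : R) (f r : R -> R) (t : R) : R :=
  m2 * c1 ^ 2 / r t ^ 2
  - 2 * m1 * m2 / dist_h m1 m2 (r t) (f t)
  - m2 ^ 2 / (2 * r t)
  + (m1 ^ 2 + 2 * m1 * m2) / (4 * m2) * Derive f t ^ 2
  + m2 * Derive r t ^ 2.

(* In the coefficients below, [s], [u], [p] stand for r, g(r), g'(r). *)

Definition coef_a (m1 m2 c1 c2 s u p : R) : R :=
  let k := kappa m1 m2 in
  (8 * (1 - k) * m2 ^ 2 * s ^ 2
   + (2 * c1 ^ 2 * m2 - s * (m2 ^ 2 + 2 * c2 * s))
     * sqrt (s ^ 2 + k ^ 2 * u ^ 2))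
  / (2 * m2 * s ^ 2 * sqrt (s ^ 2 + k ^ 2 * u ^ 2)
     * (1 + (k - 1) * k * p ^ 2)).

Definition coef_b (m1 m2 c1 s u : R) : R :=
  let k := kappa m1 m2 in
  - (c1 ^ 2 / s ^ 3 - m2 / (4 * s ^ 2)
     - 2 * (k - 1) * m2 * s / Rpower (s ^ 2 + k ^ 2 * u ^ 2) (3 / 2)).

Definition coef_c (m1 m2 s u : R) : R :=
  let k := kappa m1 m2 in
  - (2 * k * m2 * u / Rpower (s ^ 2 + k ^ 2 * u ^ 2) (3 / 2)).

(* Main.v *)
(** Along the orbit [f = g o r] and [r' <> 0], so [g' o r = f' / r'], and
    differentiating again gives [f'' = (g'' o r) r'^2 + (g' o r) r''].
    The equations of motion say [b = - r''] and [c = f''], while conservation of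
    energy, solved for [r'^2] after substituting [f' = (g' o r) r'], says
    [a = - r'^2]; the claimed equation is the preceding identity rearranged.
    Differentiability of [g] needs no inverse function: since [r' <> 0], [r] maps
    neighbourhoods onto neighbourhoods, and an increment of [g] at [r t] is an
    increment of [f] at [t]. *)
Require Import Defs.
From Stdlib Require Import Reals Lra ClassicalEpsilon Ranalysis5.
From Coquelicot Require Import Coquelicot.
Open Scope R_scope.

(** * Intervals of time and the mean value theorem *)

Lemma time_interval_locally (a b : Rbar) (t : R) :
  time_interval a b t -> locally t (time_interval a b).
Proof.
  intros [Ha Hb].
  apply filter_and.
  - exact (open_Rbar_gt' t a Ha).
  - exact (open_Rbar_lt' t b Hb).
Qed.

Lemma time_interval_convex (a b : Rbar) (t u v : R) :
  time_interval a b t -> time_interval a b u -> t <= v <= u ->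
  time_interval a b v.
Proof.
  intros [Ha _] [_ Hb] [Htv Hvu].
  split.
  - exact (Rbar_lt_le_trans a t v Ha Htv).
  - exact (Rbar_le_lt_trans v u b Hvu Hb).
Qed.

Lemma time_interval_Rmin_Rmax (a b : Rbar) (t u v : R) :
  time_interval a b t -> time_interval a b u -> Rmin t u <= v <= Rmax t u ->
  time_interval a b v.
Proof.
  intros Ht Hu.
  unfold Rmin, Rmax; destruct (Rle_dec t u).
  - now apply time_interval_convex.
  - now apply time_interval_convex.
Qed.

(** The mean value theorem writes [r u - r t] as [dr v * (u - t)] with [v] in the interval, and
    [dr v] is nonzero. *)
Lemma is_derive_nonzero_injective (a b : Rbar) (r dr : R -> R) :
  (forall t, time_interval a b t -> is_derive r t (dr t)) ->
  (forall t, time_interval a b t -> dr t <> 0) ->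
  forall t u, time_interval a b t -> time_interval a b u ->
  r t = r u -> t = u.
Proof.
  intros Hr Hdr t u Ht Hu E.
  destruct (MVT_gen r t u dr) as [v [Hv Eq]].
  - intros v Hv; apply Hr, (time_interval_Rmin_Rmax a b t u); lra || easy.
  - intros v Hv; apply continuity_pt_filterlim, (ex_derive_continuous r).
    exists (dr v); apply Hr, (time_interval_Rmin_Rmax a b t u); easy.
  - assert (H := Hdr v (time_interval_Rmin_Rmax a b t u v Ht Hu Hv)).
    replace (r u - r t) with 0 in Eq by lra.
    symmetry in Eq; apply Rmult_integral in Eq; lra.
Qed.

Lemma is_derive_zero_constant (a b : Rbar) (e : R -> R) :
  (forall t, time_interval a b t -> is_derive e t 0) ->
  forall t u, time_interval a b t -> time_interval a b u -> e t = e u.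
Proof.
  intros He t u Ht Hu.
  destruct (MVT_gen e t u (fun _ => 0)) as [v [Hv Eq]].
  - intros v Hv; apply He, (time_interval_Rmin_Rmax a b t u); lra || easy.
  - intros v Hv; apply continuity_pt_filterlim, (ex_derive_continuous e).
    exists 0; apply He, (time_interval_Rmin_Rmax a b t u); easy.
  - lra.
Qed.

(** * Change of variable from [t] to [r t] *)

Lemma is_derive_remainder (f : R -> R) (t l eps : R) :
  is_derive f t l -> 0 < eps ->
  locally t (fun u => Rabs (f u - f t - l * (u - t)) <= eps * Rabs (u - t)).
Proof.
  intros [_ H] Heps.
  generalize (H t (fun P HP => HP) (mkposreal eps Heps)).
  apply filter_imp; intros u Hu.
  unfold norm, minus, plus, opp, scal in Hu; simpl in Hu.
  unfold abs, mult in Hu; simpl in Hu.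
  replace (f u - f t - l * (u - t)) with (f u + - f t + - ((u + - t) * l)) by ring.
  exact Hu.
Qed.

Lemma is_derive_of_remainder (g : R -> R) (s l : R) :
  (forall eps, 0 < eps -> locally s (fun v =>
     Rabs (g v - g s - l * (v - s)) <= eps * Rabs (v - s))) ->
  is_derive g s l.
Proof.
  intros H.
  split.
  - apply is_linear_scal_l.
  - intros s' Hs'.
    apply (is_filter_lim_locally_unique (K := R_AbsRing) (V := AbsRing_NormedModule R_AbsRing)) in Hs'; subst s'.
    intros eps.
    generalize (H eps (cond_pos eps)).
    apply filter_imp; intros u Hu.
    unfold norm, minus, plus, opp, scal; simpl.
    unfold abs, mult; simpl.
    replace (g u + - g s + - ((u + - s) * l)) with (g u - g s - l * (u - s)) by ring.
    exact Hu.
Qed.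

(** By the first-order estimate, the values of [r] at [t - d] and [t + d] lie on opposite sides of
    [r t], at distance at least [Rabs dr / 2 * d]. The intermediate value theorem attains every
    closer value. *)
Lemma derive_nonzero_locally_onto (r : R -> R) (t dr : R) (P : R -> Prop) :
  is_derive r t dr -> dr <> 0 -> locally t (continuous r) -> locally t P ->
  locally (r t) (fun s => exists u, r u = s /\ P u).
Proof.
  intros Hr Hdr Hc HP.
  assert (Hd : 0 < Rabs dr) by now apply Rabs_pos_lt.
  assert (Hd2 : 0 < Rabs dr / 2) by lra.
  destruct (filter_and _ _ (filter_and _ _ Hc HP)
              (is_derive_remainder r t dr _ Hr Hd2)) as [e He].
  (* Half the radius keeps the closed interval used below inside the open ball. *)
  assert (Hin : forall u, Rabs (u - t) <= e / 2 ->
     (continuous r u /\ P u) /\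
     Rabs (r u - r t - dr * (u - t)) <= Rabs dr / 2 * Rabs (u - t)).
  { intros u Hu; apply He.
    change (Rabs (u - t) < e); destruct e as [e0 e0pos]; simpl in *; lra. }
  assert (Hd3 : 0 < Rabs dr / 2 * (e / 2)).
  { apply Rmult_lt_0_compat; [easy | destruct e; simpl; lra]. }
  exists (mkposreal _ Hd3); intros s Hs.
  change (Rabs (s - r t) < Rabs dr / 2 * (e / 2)) in Hs.
  assert (He2 : 0 < e / 2) by (destruct e; simpl; lra).
  set (d := e / 2) in *.
  (* The factor [dr] makes the function negative at [t - d] and positive at [t + d] whatever the
     sign of [dr]. *)
  destruct (IVT_interv (fun u => dr * (r u - s)) (t - d) (t + d)) as [u [Hu Eu]].
  - intros u Hu.
    assert (Cu : continuous r u).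
    { apply Hin, Rabs_le; lra. }
    apply continuity_pt_filterlim.
    apply (continuous_scal_r (K := R_AbsRing) (V := R_NormedModule) dr (fun u => r u - s)).
    apply (continuous_minus (V := R_NormedModule) r (fun _ => s)); [easy | apply continuous_const].
  - lra.
  - destruct (Hin (t - d)) as [_ H].
    { apply Rabs_le; lra. }
    replace (t - d - t) with (- d) in H by ring.
    rewrite Rabs_Ropp, (Rabs_pos_eq d) in H by lra.
    revert H Hs Hd; unfold Rabs; repeat destruct Rcase_abs; intros; nra.
  - destruct (Hin (t + d)) as [_ H].
    { apply Rabs_le; lra. }
    replace (t + d - t) with d in H by ring.
    rewrite (Rabs_pos_eq d) in H by lra.
    revert H Hs Hd; unfold Rabs; repeat destruct Rcase_abs; intros; nra.
  - exists u; split.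
    + apply Rmult_integral in Eu; lra.
    + apply Hin, Rabs_le; lra.
Qed.

(** The function [f - df / dr * r] has derivative 0 at [t], and its increment is the remainder of
    [g] at [r t]. So this remainder is o(u - t), hence o(r u - r t) because [dr <> 0]. *)
Lemma is_derive_factor (f r g : R -> R) (t df dr : R) :
  is_derive f t df -> is_derive r t dr -> dr <> 0 ->
  locally t (continuous r) -> locally t (fun u => f u = g (r u)) ->
  is_derive g (r t) (df / dr).
Proof.
  intros Hf Hr Hdr Hc Hg.
  assert (Hd : 0 < Rabs dr) by now apply Rabs_pos_lt.
  assert (Hphi : is_derive (fun u => f u - df / dr * r u) t 0).
  { replace 0 with (df - df / dr * dr) by (field; easy).
    apply (is_derive_minus (V := R_NormedModule)); [easy |].
    now apply (is_derive_scal r). }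
  apply is_derive_of_remainder; intros eps Heps.
  assert (Hd2 : 0 < Rabs dr / 2) by lra.
  assert (He : 0 < eps * (Rabs dr / 2)) by now apply Rmult_lt_0_compat.
  generalize (derive_nonzero_locally_onto r t dr _ Hr Hdr Hc
    (filter_and _ _ Hg (filter_and _ _
       (is_derive_remainder _ t 0 _ Hphi He)
       (is_derive_remainder r t dr _ Hr Hd2)))).
  apply filter_imp; intros s (u & <- & Eu & H1 & H2).
  rewrite <- Eu, <- (locally_singleton _ _ Hg).
  replace (f u - f t - df / dr * (r u - r t))
    with (f u - df / dr * r u - (f t - df / dr * r t) - 0 * (u - t)) by ring.
  apply (Rle_trans _ _ _ H1).
  rewrite Rmult_assoc; apply Rmult_le_compat_l; [lra |].
  (* The deviation of [r] from its linear part is at most half of that part, whence [Rabs dr / 2 *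
     Rabs (u - t) <= Rabs (r u - r t)]. *)
  assert (H3 := Rabs_triang_inv (dr * (u - t)) (- (r u - r t - dr * (u - t)))).
  assert (H4 := Rabs_triang (r u - r t) (- (r u - r t - dr * (u - t)))).
  rewrite Rabs_Ropp in H4.
  replace (r u - r t + - (r u - r t - dr * (u - t))) with (dr * (u - t)) in H4 by ring.
  rewrite Rabs_mult in H4; lra.
Qed.

(** * Conservation of energy *)

Lemma dist_h_pos (m1 m2 s u : R) : 0 < s -> 0 < dist_h m1 m2 s u.
Proof.
  intros Hs; apply sqrt_lt_R0.
  assert (H := pow2_ge_0 (kappa m1 m2 * u)); nra.
Qed.

Lemma Rpower_3_2_dist_h (m1 m2 s u : R) : 0 < s ->
  Rpower (s ^ 2 + kappa m1 m2 ^ 2 * u ^ 2) (3 / 2) = dist_h m1 m2 s u ^ 3.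
Proof.
  intros Hs.
  assert (H := pow2_ge_0 (kappa m1 m2 * u)).
  unfold dist_h.
  rewrite <- Rpower_sqrt by nra.
  rewrite <- (Rpower_pow 3 (Rpower _ _)) by apply exp_pos.
  rewrite Rpower_mult; f_equal; simpl; lra.
Qed.

(** With k = [kappa m1 m2], one has m1 = 2 m2 (k - 1), and f'^2 has coefficient m2 k (k - 1). The
    terms in f' then cancel by the equation for f'', those in r' by the equation for r''. *)
Lemma is_derive_total_energy (m1 m2 c1 : R) (f r : R -> R) (t : R) :
  0 < m1 -> 0 < m2 -> 0 < r t -> ex_derive f t -> ex_derive r t ->
  is_derive (Derive f) t
    (- (2 * m2 * kappa m1 m2 * f t) / dist_h m1 m2 (r t) (f t) ^ 3) ->
  is_derive (Derive r) t
    (c1 ^ 2 / r t ^ 3 - m2 / (4 * r t ^ 2)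
     - 2 * (kappa m1 m2 - 1) * m2 * (r t / dist_h m1 m2 (r t) (f t) ^ 3)) ->
  is_derive (total_energy m1 m2 c1 f r) t 0.
Proof.
  intros Hm1 Hm2 Hr Hf' Hr' Hf'' Hr''.
  assert (Hh := dist_h_pos m1 m2 (r t) (f t) Hr).
  assert (Hk := pow2_ge_0 (kappa m1 m2 * f t)).
  assert (Hpos : 0 < r t ^ 2 + kappa m1 m2 ^ 2 * f t ^ 2) by nra.
  unfold total_energy, dist_h.
  auto_derive.
  - repeat split; try assumption; try lra; try nra.
    + apply Rgt_not_eq, sqrt_lt_R0; nra.
    + eexists; exact Hf''.
    + eexists; exact Hr''.
  - change (fun x => Derive f x) with (Derive f).
    change (fun x => Derive r x) with (Derive r).
    rewrite (is_derive_unique _ _ _ Hf''), (is_derive_unique _ _ _ Hr'').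
    change (fun x => f x) with f; change (fun x => r x) with r.
    unfold dist_h in *.
    replace (r t * (r t * 1) + kappa m1 m2 * (kappa m1 m2 * 1) * (f t * (f t * 1)))
      with (r t ^ 2 + kappa m1 m2 ^ 2 * f t ^ 2) by ring.
    unfold kappa in *.
    field; repeat split; lra.
Qed.

Theorem theorem2p9 (m1 m2 c1 c2 : R) (hm1 : 0 < m1) (hm2 : 0 < m2)
    (ta tb : Rbar) (x y z : R -> R3) (f r theta : R -> R)
    (hsol : symmetric_solution m1 m2 c1 (time_interval ta tb) x y z f r theta)
    (t0 : R) (ht0 : time_interval ta tb t0)
    (hc2 : c2 = total_energy m1 m2 c1 f r t0)
    (a b : Rbar)
    (hsub : forall t : R, time_interval a b t -> time_interval ta tb t)
    (hr' : forall t : R, time_interval a b t -> Derive r t <> 0) :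
  (exists g : R -> R, forall t : R, time_interval a b t -> f t = g (r t)) /\
  (forall g : R -> R,
     (forall t : R, time_interval a b t -> f t = g (r t)) ->
     forall s : R, (exists t : R, time_interval a b t /\ r t = s) ->
       ex_derive g s /\ ex_derive (Derive g) s /\
       coef_a m1 m2 c1 c2 s (g s) (Derive g s) * Derive (Derive g) s
       + coef_b m1 m2 c1 s (g s) * Derive g s
       + coef_c m1 m2 s (g s) = 0).
Proof.
  destruct hsol as [_ _ _ _ Hpos Hf Hr _ Hf2 Hr2 _].
  assert (Hc : forall t, time_interval a b t -> locally t (continuous r)).
  { intros t Ht; generalize (time_interval_locally a b t Ht).
    apply filter_imp; intros u Hu; apply (ex_derive_continuous r), Hr, hsub, Hu. }
  split.
  (* [epsilon] picks an instant at which [r] equals [s], unique by injectivity; 0 only witnesses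
     that the type is inhabited. *)
  - exists (fun s => f (epsilon (inhabits 0)
                          (fun t => time_interval a b t /\ r t = s))).
    intros t Ht; f_equal.
    destruct (epsilon_spec (inhabits 0)
                (fun u => time_interval a b u /\ r u = r t)) as [Hu Eu].
    { now exists t. }
    apply (is_derive_nonzero_injective a b r (Derive r)); try easy.
    intros u Hu'; apply Derive_correct, Hr, hsub, Hu'.
  - intros g Hg s (t & Ht & <-).
    (* This is needed on the whole interval, since g'' requires g' near [r t]. *)
    assert (Dg : forall u, time_interval a b u ->
      is_derive g (r u) (Derive f u / Derive r u)).
    { intros u Hu; apply (is_derive_factor f r g u).
      - apply Derive_correct, Hf, hsub, Hu.
      - apply Derive_correct, Hr, hsub, Hu.
      - now apply hr'.
      - now apply Hc.
      - generalize (time_interval_locally a b u Hu); now apply filter_imp. }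
    pose proof (hsub t Ht) as Ht'.
    pose proof (hr' t Ht) as Hr'.
    (* The same lemma with f'/r' for [f] and g' for [g] gives g'' = (f'' r' - f' r'') / r'^3. *)
    assert (D2g := is_derive_factor (fun u => Derive f u / Derive r u) r (Derive g) t _ _
      (is_derive_div _ _ t _ _ (Hf2 t Ht') (Hr2 t Ht') Hr')
      (Derive_correct r t (Hr t Ht')) Hr' (Hc t Ht)).
    match type of D2g with ?A -> _ => assert (HA : A) end.
    { generalize (time_interval_locally a b t Ht); apply filter_imp.
      intros u Hu; symmetry; apply is_derive_unique, Dg, Hu. }
    specialize (D2g HA).
    split; [eexists; apply Dg, Ht | split; [eexists; apply D2g |]].
    rewrite (is_derive_unique _ _ _ D2g), (is_derive_unique _ _ _ (Dg t Ht)).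
    rewrite <- (Hg t Ht).
    (* Energy is constant on the larger interval, which contains both [t0] and [t]. *)
    assert (E : c2 = total_energy m1 m2 c1 f r t).
    { rewrite hc2; apply (is_derive_zero_constant ta tb); try easy.
      intros u Hu; apply is_derive_total_energy; auto. }
    pose proof (Hpos t Ht') as Hrt.
    (* Inserting the energy for [c2] turns the numerator into -2 m2 r^2 h (r'^2 + k (k - 1) f'^2).
       With p = f'/r', the bracket is r'^2 (1 + k (k - 1) p^2), whose last factor is positive as k >
       1. *)
    assert (Ha : coef_a m1 m2 c1 c2 (r t) (f t) (Derive f t / Derive r t)
                 = - Derive r t ^ 2).
    { assert (Hh := dist_h_pos m1 m2 (r t) (f t) Hrt).
      assert (Hq : 0 < 1 + (kappa m1 m2 - 1) * kappa m1 m2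
                         * (Derive f t / Derive r t) ^ 2).
      { assert (H := pow2_ge_0 (Derive f t / Derive r t)).
        assert (0 < (kappa m1 m2 - 1) * kappa m1 m2).
        { unfold kappa.
          replace (_ * _) with (m1 * (m1 + 2 * m2) / (4 * m2 ^ 2)) by (field; lra).
          apply Rdiv_lt_0_compat; nra. }
        nra. }
      rewrite E; unfold coef_a, total_energy.
      fold (dist_h m1 m2 (r t) (f t)).
      apply (Rmult_eq_reg_r (1 + (kappa m1 m2 - 1) * kappa m1 m2
                         * (Derive f t / Derive r t) ^ 2)); [| lra].
      unfold Rdiv at 1; rewrite Rinv_mult, <- Rmult_assoc.
      rewrite Rmult_assoc, Rinv_l, Rmult_1_r by lra.
      revert Hh; generalize (dist_h m1 m2 (r t) (f t)); intros h Hh.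
      unfold kappa; field; repeat split; lra. }
    rewrite Ha.
    unfold coef_b, coef_c; rewrite Rpower_3_2_dist_h by easy.
    assert (Hh := dist_h_pos m1 m2 (r t) (f t) Hrt).
    (* What remains is -r'^2 g'' - r'' f'/r' + f'' = 0 with g'' as above. *)
    field; repeat split; lra.
Qed.
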